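(* Let $F\subset\mathbb{R}^d$ be a compact convex set with $0\in\operatorname{int}(F)$, let $m\ge 2$, $2\le k\le m$, $I=\{1,\dots,m\}$, and let $\Omega^1,\dots,\Omega^m\subset\mathbb{R}^d$ be nonempty compact sets. Let $\overline{x}=(\overline{x}^1,\dots,\overline{x}^k)\in S_k$. Assume that there exist $i_0\in I$, $\omega^{i_0}\in\Omega^{i_0}$ and $j\in\{1,\dots,k\}$ such that $\overline{x}^j\notin\Omega^{i_0}[r^{i_0}]$, where $$r^{i_0}=(\|F\|\,\|F^\circ\|)^2\left(\sum_{p\in I}T_F(\omega^{i_0},\Omega^p)+\frac{\max\{T_F(\omega^{i_0},\omega)\mid\omega\in\bigcup_{p\in I}\Omega^p\}}{\|F\|\,\|F^\circ\|}\right).$$ Then $\overline{x}^{-j}=(\overline{x}^1,\dots,\overline{x}^{j-1},\overline{x}^{j+1},\dots,\overline{x}^k)\in S_{k-1}$, and the set $S_k$ is unbounded.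
   Context: $\mathbb{R}^d$ ($d\ge1$) carries the Euclidean norm $\|\cdot\|$. $F^\circ=\{y\in\mathbb{R}^d\mid\langle y,x\rangle\le1\ \text{for all }x\in F\}$ is the polar of $F$; $\|F\|=\sup\{\|x\|\mid x\in F\}$ and $\|F^\circ\|=\sup\{\|y\|\mid y\in F^\circ\}$. For a nonempty set $\Omega\subset\mathbb{R}^d$ the minimal time function is $T_F(x,\Omega)=\inf\{t\ge 0\mid (x+tF)\cap\Omega\neq\emptyset\}$; $T_F(x,\omega)$ means $T_F(x,\{\omega\})$. For $r\ge0$ the enlargement is $\Omega[r]=\{x\in\mathbb{R}^d\mid T_F(x,\Omega)\le r\}$. For each integer $1\le\ell\le m$ and $x=(x^1,\dots,x^\ell)\in(\mathbb{R}^d)^\ell=\mathbb{R}^{d\ell}$, $f_\ell(x)=\sum_{i=1}^m\min_{1\le j\le \ell}T_F(x^j,\Omega^i)$, and $S_\ell=\{y\in\mathbb{R}^{d\ell}\mid f_\ell(y)=\min_{x\in\mathbb{R}^{d\ell}}f_\ell(x)\}$. *)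

(* Defs.v *)
From mathcomp Require Import all_boot all_order all_algebra.
From mathcomp Require Import all_classical all_reals all_analysis.

Set Implicit Arguments.
Unset Strict Implicit.
Unset Printing Implicit Defensive.

Import Order.TTheory GRing.Theory Num.Theory numFieldNormedType.Exports.

Local Open Scope classical_set_scope.
Local Open Scope ring_scope.

(* The library's norm on ['rV[R]_d] is the sup norm, which gives the same
   topology and the same bounded sets as the Euclidean norm but not the same
   values; hence the Euclidean norm below. *)
Definition dot (R : realType) (d : nat) (x y : 'rV[R]_d) : R :=
  \sum_(i < d) x ord0 i * y ord0 i.

Definition enorm (R : realType) (d : nat) (x : 'rV[R]_d) : R :=
  Num.sqrt (dot x x).

Definition polar (R : realType) (d : nat) (F : set 'rV[R]_d) : set 'rV[R]_d :=
  [set y | forall x, F x -> dot y x <= 1].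

(* [sup] and [inf] are real-valued, with junk value 0 on empty or unbounded
   sets.  When F is compact with 0 in its interior, the suprema and infima
   below are over nonempty sets bounded on the relevant side. *)
Definition set_norm (R : realType) (d : nat) (F : set 'rV[R]_d) : R :=
  sup [set enorm x | x in F].

Definition min_time (R : realType) (d : nat) (F : set 'rV[R]_d)
    (x : 'rV[R]_d) (Omega : set 'rV[R]_d) : R :=
  inf [set t : R | 0 <= t /\ [set x + t *: v | v in F] `&` Omega !=set0].

Definition enlargement (R : realType) (d : nat) (F Omega : set 'rV[R]_d)
    (r : R) : set 'rV[R]_d :=
  [set x | min_time F x Omega <= r].

(* A point of (R^d)^l is an l x d matrix whose rows are its components.  For
   l >= 1 the inner infimum is over a nonempty finite set, so it is a minimum;
   l = 0 is not meaningful. *)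
Definition objective (R : realType) (d m : nat) (F : set 'rV[R]_d)
    (Omega : 'I_m -> set 'rV[R]_d) (l : nat) (x : 'M[R]_(l, d)) : R :=
  \sum_(i < m) inf (range (fun j : 'I_l => min_time F (row j x) (Omega i))).

Definition solutions (R : realType) (d m : nat) (F : set 'rV[R]_d)
    (Omega : 'I_m -> set 'rV[R]_d) (l : nat) : set 'M[R]_(l, d) :=
  [set y | forall x : 'M[R]_(l, d), objective F Omega y <= objective F Omega x].

(* The supremum over the union of the Omega p is a maximum when these sets are
   compact and nonempty, since [min_time F w [set w']] is continuous in w'. *)
Definition removal_radius (R : realType) (d m : nat) (F : set 'rV[R]_d)
    (Omega : 'I_m -> set 'rV[R]_d) (w : 'rV[R]_d) : R :=
  (set_norm F * set_norm (polar F)) ^+ 2 *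
  (\sum_(p < m) min_time F w (Omega p) +
   sup [set min_time F w [set w'] | w' in \bigcup_(p in [set: 'I_m]) Omega p]
     / (set_norm F * set_norm (polar F))).

Arguments solutions {R d m} F Omega l.

(* Main.v *)
(* Write K = |F| |F°|, S for the sum of the T_F(w, Omega p), and M for the
   largest T_F(w, w').  Since F is the polar of its polar, T_F(y, x) is at most
   K T_F(x, y), so the triangle inequality shows that the row j of xbar is at
   distance more than (K^2 S + K M) - K M >= S from every Omega p.  Putting all
   facilities at w costs at most S, hence at the optimum each Omega p is served
   at cost at most S, never by the row j.  That row can thus be deleted, or
   moved anywhere, without increasing the cost. *)
Require Import Defs.
From mathcomp Require Import all_boot all_order all_algebra.
From mathcomp Require Import ring lra.
From mathcomp Require Import all_classical all_reals all_analysis.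

Set Implicit Arguments.
Unset Strict Implicit.
Unset Printing Implicit Defensive.

Import Order.TTheory GRing.Theory Num.Theory numFieldNormedType.Exports.
Local Open Scope classical_set_scope.
Local Open Scope ring_scope.

(** * The Euclidean norm *)

Section Euclidean.

Context {R : realType} {d : nat}.
Implicit Type a : R.
Implicit Types x y z v : 'rV[R]_d.
Implicit Type A : set 'rV[R]_d.

Lemma dotC x y : dot x y = dot y x.
Proof. by apply: eq_bigr => i _; rewrite mulrC. Qed.

Lemma dotDl x y z : dot (x + y) z = dot x z + dot y z.
Proof. by rewrite -big_split; apply: eq_bigr => i _; rewrite mxE mulrDl. Qed.

Lemma dotZl a x y : dot (a *: x) y = a * dot x y.
Proof. by rewrite mulr_sumr; apply: eq_bigr => i _; rewrite mxE mulrA. Qed.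

Lemma dotDr x y z : dot x (y + z) = dot x y + dot x z.
Proof. by rewrite !(dotC x) dotDl. Qed.

Lemma dotZr a x y : dot x (a *: y) = a * dot x y.
Proof. by rewrite !(dotC x) dotZl. Qed.

Lemma dotNl x y : dot (- x) y = - dot x y.
Proof. by rewrite -scaleN1r dotZl mulN1r. Qed.

Lemma dotNr x y : dot x (- y) = - dot x y.
Proof. by rewrite !(dotC x) dotNl. Qed.

Lemma dot_ge0 x : 0 <= dot x x.
Proof. by apply: sumr_ge0 => i _; rewrite -expr2 sqr_ge0. Qed.

Lemma dot_eq0 x : (dot x x == 0) = (x == 0).
Proof.
apply/idP/eqP => [|->]; last by rewrite /dot big1 // => i _; rewrite mxE mul0r.
rewrite psumr_eq0 => [/allP x0|i _]; last by rewrite -expr2 sqr_ge0.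
apply/rowP => i; apply/eqP; rewrite mxE.
by have := x0 i (mem_index_enum i); rewrite mulf_eq0 orbb.
Qed.

Lemma dotDD x y : dot (x + y) (x + y) = dot x x + 2 * dot x y + dot y y.
Proof. by rewrite dotDl !dotDr (dotC y x); ring. Qed.

Lemma enorm_ge0 x : 0 <= enorm x.
Proof. exact: sqrtr_ge0. Qed.

Lemma sqr_enorm x : enorm x ^+ 2 = dot x x.
Proof. by rewrite sqr_sqrtr ?dot_ge0. Qed.

Lemma enorm_gt0 x : (0 < enorm x) = (x != 0).
Proof. by rewrite sqrtr_gt0 lt0r dot_ge0 dot_eq0 andbT. Qed.

Lemma enormZ a x : enorm (a *: x) = `|a| * enorm x.
Proof.
by rewrite /enorm dotZl dotZr mulrA -expr2 sqrtrM ?sqr_ge0// sqrtr_sqr.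
Qed.

Lemma enormN x : enorm (- x) = enorm x.
Proof. by rewrite -scaleN1r enormZ normrN1 mul1r. Qed.

(** Cauchy-Schwarz: with [a], [b] the norms and [c] the dot product, the squared norm of
    [b *: x - a *: y] is [2 * (a * b) * (a * b - c)]. For nonzero vectors the positive factor can be
    divided out. *)
Lemma dot_le_enorm x y : dot x y <= enorm x * enorm y.
Proof.
have [->|x0] := eqVneq x 0.
  by rewrite -(scale0r 0) dotZl mul0r mulr_ge0 ?enorm_ge0.
have [->|y0] := eqVneq y 0.
  by rewrite -(scale0r 0) dotZr mul0r mulr_ge0 ?enorm_ge0.
have := dot_ge0 (enorm y *: x - enorm x *: y).
rewrite dotDD dotNl !dotNr !dotZl !dotZr -!sqr_enorm.
rewrite -!enorm_gt0 in x0 y0; have xy := mulr_gt0 x0 y0.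
set a := enorm x in x0 xy *; set b := enorm y in y0 xy *; set c := dot x y.
move=> h; rewrite -subr_ge0 -(pmulr_rge0 _ xy).
rewrite -(pmulr_rge0 _ (ltr0n R 2)) (le_trans h)// le_eqVlt.
by apply/predU1P; left; ring.
Qed.

Lemma enormD x y : enorm (x + y) <= enorm x + enorm y.
Proof.
rewrite -(@ler_pXn2r _ 2) ?nnegrE ?addr_ge0 ?enorm_ge0//.
rewrite sqr_enorm dotDD -!sqr_enorm sqrrD lerD2r lerD2l -[leRHS]mulr_natl.
by rewrite ler_pM2l ?dot_le_enorm.
Qed.

(** Serves with [v = 0] to bound norms on a compact set, and with general [v] to project onto
    [F]. *)
Lemma dot_sub_continuous v : continuous (fun x => dot (x - v) (x - v)).
Proof.
apply: continuous_big => [|i _ x]; first exact: add_continuous.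
have c : {for x, continuous (fun y : 'rV[R]_d => (y - v) ord0 i)}.
  rewrite (_ : (fun _ => _) = fun y : 'rV[R]_d => y ord0 i - v ord0 i).
    by apply: continuousB; [exact: coord_continuous|exact: cst_continuous].
  by apply/funext => y; rewrite !mxE.
exact: continuousM.
Qed.

Lemma enorm_compact_bounded A : compact A ->
  has_ubound [set enorm x | x in A].
Proof.
have [->|/set0P A0] := eqVneq A set0; first by exists 0 => ? [? []].
move=> Ac; have [|c _ cmax] := compact_EVT_max A0 Ac
  (f := fun x => dot (x - 0) (x - 0)).
  by apply: continuous_subspaceT; exact: dot_sub_continuous.
exists (enorm c) => _ [x Ax <-]; rewrite ler_wsqrtr//.
by have := cmax x (mem_set Ax); rewrite !subr0.
Qed.

(** Balls given by the topology are sup-norm balls; this places Euclidean balls inside them. *)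
Lemma norm_le_enorm x : `|x| <= enorm x.
Proof.
rewrite /Num.norm/= mx_normrE; apply: bigmax_le => [|[i c] _ /=].
  exact: enorm_ge0.
rewrite -(ler_pXn2r (ltn0Sn 1)) ?nnegrE ?enorm_ge0// sqr_enorm.
rewrite real_normK ?num_real// (ord1 i) expr2 /dot (bigD1 c)//= lerDl.
by apply: sumr_ge0 => e _; rewrite -expr2 sqr_ge0.
Qed.

End Euclidean.

(** * The minimal time function *)

Section MinTime.

Context {R : realType} {d : nat} (F : set 'rV[R]_d).
Context (Fcompact : compact F) (Fconvex : convex_set F) (F0 : interior F 0).
Implicit Types a t : R.
Implicit Types u v x y z : 'rV[R]_d.
Implicit Type Omega : set 'rV[R]_d.

(** * Absorption by [F] and duality with its polar *)

Lemma F_origin : F 0.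
Proof. exact: nbhs_singleton. Qed.

Lemma F_conv a x y : F x -> F y -> 0 <= a -> a <= 1 ->
  F (a *: x + (1 - a) *: y).
Proof.
move=> Fx Fy a0 a1.
by have /set_mem := Fconvex (Itv01 a0 a1) (mem_set Fx) (mem_set Fy).
Qed.

Lemma F_ball : exists2 e : R, 0 < e & forall x, `|x| < e -> F x.
Proof. by have [e] := (nbhs_norm0P (P := F)).1 F0; exists e. Qed.

Lemma F_scaler u : exists2 a, 0 < a & F (a *: u).
Proof.
have [e e0 eF] := F_ball.
have u1 : 0 < `|u| + 1 by rewrite ltr_wpDl.
exists (e / (`|u| + 1)); first by rewrite divr_gt0.
apply: eF => /=; rewrite normrZ ger0_norm ?divr_ge0 ?ltW//.
by rewrite mulrAC ltr_pdivrMr// ltr_pM2l// ltrDl.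
Qed.

(** [F] contains a ball, so a nonzero [y] can be tested against its own positive multiple of norm
    [e / 2]. *)
Lemma polar_enorm_bounded : has_ubound [set enorm y | y in polar F].
Proof.
have [e e0 eF] := F_ball.
exists (2 / e) => _ [y yF <-].
have [->|] := eqVneq y 0.
  by rewrite -(scale0r 0) enormZ normr0 mul0r divr_ge0// ltW.
rewrite -enorm_gt0 => y0.
have a0 : 0 < e / (2 * enorm y) by rewrite divr_gt0// mulr_gt0.
have /yF : F ((e / (2 * enorm y)) *: y).
  apply: eF => /=; apply: le_lt_trans (norm_le_enorm _) _.
  rewrite enormZ gtr0_norm//.
  rewrite (_ : e / (2 * enorm y) * enorm y = e / 2); first by lra.
  by field; rewrite gt_eqF.
rewrite dotZr -sqr_enorm (_ : _ * enorm y ^+ 2 = e * enorm y / 2); last first.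
  by field; rewrite gt_eqF.
by rewrite ler_pdivrMr// ler_pdivlMr// mul1r mulrC.
Qed.

Lemma polar_set_norm_ge y : polar F y -> enorm y <= set_norm (polar F).
Proof.
by move=> yF; apply: ub_le_sup; [exact: polar_enorm_bounded|exists y].
Qed.

Lemma set_norm_ge x : F x -> enorm x <= set_norm F.
Proof.
by move=> Fx; apply: ub_le_sup; [exact: enorm_compact_bounded|exists x].
Qed.

Lemma polar_set_norm_ge0 : 0 <= set_norm (polar F).
Proof.
apply: le_trans (enorm_ge0 (0 : 'rV[R]_d)) _.
by apply: polar_set_norm_ge => x _; rewrite -(scale0r 0) dotZl mul0r.
Qed.

(* The nearest point [p] of [F] to [v] supports [F] in the direction [v - p]. *)
Lemma exists_projection v : exists2 p, F p &
  forall x, F x -> dot (v - p) x <= dot (v - p) p.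
Proof.
have [||p /set_mem Fp pmin] := compact_EVT_min _ Fcompact
    (f := fun x => dot (x - v) (x - v)).
- by exists 0; exact: F_origin.
- by apply: continuous_subspaceT; exact: dot_sub_continuous.
exists p => // x Fx; rewrite -subr_le0 -dotNr -dotDr leNgt; apply/negP.
set c := dot _ _; move=> c0; pose D := dot (x - p) (x - p).
have D0 : 0 <= D by exact: dot_ge0.
have Dc : 0 < D + c by exact: ltr_wpDl.
(* Moving from [p] towards [x] by [c / (D + c)] gets closer to [v]. *)
pose a := c / (D + c).
have a0 : 0 < a by rewrite divr_gt0.
have a1 : a <= 1 by rewrite ler_pdivrMr// mul1r lerDr.
have := pmin _ (mem_set (F_conv Fx Fp (ltW a0) a1)).
rewrite (_ : a *: x + (1 - a) *: p - v = (p - v) + a *: (x - p)); last first.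
  by apply/rowP => i; rewrite !mxE; ring.
rewrite (dotDD (p - v)) dotZl !dotZr -/D -(opprB v p).
rewrite (dotNl _ (x - p)) -/c => h.
(* Minimality forces [2 * c <= a * D], whereas the choice of [a] gives [a * D <= c]. *)
have : 0 <= a * (a * D - 2 * c) by lra.
rewrite pmulr_rge0// subr_ge0 /a mulrAC ler_pdivlMr//; nra.
Qed.

(** Half of the bipolar theorem: the supporting direction [u = v - p] at the projection [p], scaled
    to take the value 1 at [p], lies in the polar and exceeds 1 at [v]. *)
Lemma polar_separation v : ~ F v -> exists2 y, polar F y & 1 < dot y v.
Proof.
move=> nFv; have [p Fp pP] := exists_projection v.
set u := v - p in pP.
have u0 : 0 < dot u u.
  rewrite lt0r dot_ge0 dot_eq0 andbT subr_eq0.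
  by apply/eqP => vp; apply: nFv; rewrite vp.
(* [F] contains a positive multiple of [u], so the maximum of [dot u] over [F], attained at [p], is
   positive. *)
have up : 0 < dot u p.
  have [a a0 /pP] := F_scaler u.
  by rewrite dotZr; apply: lt_le_trans; rewrite mulr_gt0.
exists ((dot u p)^-1 *: u) => [x Fx|].
  by rewrite dotZl mulrC ler_pdivrMr// mul1r pP.
rewrite dotZl mulrC ltr_pdivlMr// mul1r -subr_gt0 -dotNr -dotDr.
exact: u0.
Qed.

(** Otherwise some [y] in the polar separates [t^-1 *: v] from [F], and [t < dot y v] contradicts
    Cauchy-Schwarz. *)
Lemma polar_absorbs v t : set_norm (polar F) * enorm v < t ->
  exists2 f, F f & v = t *: f.
Proof.
move=> vt.
have t0 : 0 < t.
  by apply: le_lt_trans vt; rewrite mulr_ge0 ?polar_set_norm_ge0 ?enorm_ge0.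
exists (t^-1 *: v); last by rewrite scalerA divff ?scale1r// gt_eqF.
apply: contrapT => /polar_separation[y yF].
rewrite dotZr mulrC ltr_pdivlMr// mul1r => ty.
have := ler_wpM2r (enorm_ge0 v) (polar_set_norm_ge yF).
have := dot_le_enorm y v.
lra.
Qed.

(** * Estimates for the minimal time function *)

Lemma min_time_le x Omega t v : 0 <= t -> F v -> Omega (x + t *: v) ->
  min_time F x Omega <= t.
Proof.
move=> t0 Fv Ov; apply: ge_inf; first by exists 0 => s [].
by split=> //; exists (x + t *: v); split=> //; exists v.
Qed.

Lemma min_time_ge x Omega c : Omega !=set0 ->
  (forall t v, 0 <= t -> F v -> Omega (x + t *: v) -> c <= t) ->
  c <= min_time F x Omega.
Proof.
move=> [y Oy] h; apply: lb_le_inf => [|t [t0 [_ [[v Fv <-]]]]]; last exact: h.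
(* Some time must reach [Omega], lest the infimum be over the empty set; the [+ 1] makes the bound
   of [polar_absorbs] strict. *)
pose t := set_norm (polar F) * enorm (y - x) + 1.
have [f Ff yx] : exists2 f, F f & y - x = t *: f.
  by apply: polar_absorbs; rewrite ltrDl.
exists t; split.
  by rewrite addr_ge0// mulr_ge0 ?polar_set_norm_ge0 ?enorm_ge0.
by exists y; split=> //; exists f => //; rewrite -yx subrKC.
Qed.

Lemma min_time_ge0 x Omega : 0 <= min_time F x Omega.
Proof.
have [->|/set0P O0] := eqVneq Omega set0; last exact: min_time_ge.
(* An empty target gives the default value 0. *)
rewrite /min_time (_ : [set t : R | _] = set0) ?inf0//.
by apply/seteqP; split=> // t [_ [y []]].
Qed.

Lemma min_time_le_enorm x y :
  min_time F x [set y] <= set_norm (polar F) * enorm (y - x).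
Proof.
apply/ler_addgt0Pr => e e0.
have [|f Ff yx] := @polar_absorbs (y - x)
  (set_norm (polar F) * enorm (y - x) + e).
  by rewrite ltrDl.
apply: (@min_time_le _ _ _ f) => //=; last by rewrite -yx subrKC.
by rewrite addr_ge0 ?mulr_ge0 ?polar_set_norm_ge0 ?enorm_ge0 ?ltW.
Qed.

Lemma set_norm_gt0 : (0 < d)%N -> 0 < set_norm F.
Proof.
move=> d0; have [a a0 Fa] := F_scaler (const_mx 1).
apply: lt_le_trans (set_norm_ge Fa); rewrite enorm_gt0.
apply/eqP => /rowP/(_ (Ordinal d0)); rewrite !mxE mulr1.
by apply/eqP; rewrite gt_eqF.
Qed.

Lemma enorm_le_min_time x y : (0 < d)%N ->
  enorm (y - x) <= set_norm F * min_time F x [set y].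
Proof.
move=> d0; rewrite -ler_pdivrMl ?set_norm_gt0//.
apply: min_time_ge => [|t v t0 Fv /= <-]; first by exists y.
rewrite addrC addKr enormZ ger0_norm// mulrC ler_pdivrMr ?set_norm_gt0//.
by rewrite ler_wpM2l// set_norm_ge.
Qed.

(** For [v] nonzero, the travel time from 0 to [v] is at least [enorm v / set_norm F] and at most
    [set_norm (polar F) * enorm v]. *)
Lemma set_norm_polar_ge1 : (0 < d)%N -> 1 <= set_norm F * set_norm (polar F).
Proof.
move=> d0; have v0 : 0 < enorm (const_mx 1 : 'rV[R]_d).
  rewrite enorm_gt0; apply/eqP => /rowP/(_ (Ordinal d0)); rewrite !mxE.
  by apply/eqP; rewrite oner_eq0.
rewrite -(ler_pM2r v0) mul1r -mulrA -[X in enorm X <= _]subr0.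
apply: le_trans (enorm_le_min_time _ _ d0) _.
by rewrite ler_pM2l ?set_norm_gt0// -[X in enorm X]subr0 min_time_le_enorm.
Qed.

(** Both travel times are compared with the Euclidean distance, which is symmetric. *)
Lemma min_time_sym x y : (0 < d)%N -> min_time F y [set x] <=
  set_norm F * set_norm (polar F) * min_time F x [set y].
Proof.
move=> d0; apply: le_trans (min_time_le_enorm _ _) _.
rewrite -enormN opprB (mulrC (set_norm F)) -mulrA ler_wpM2l ?polar_set_norm_ge0//.
exact: enorm_le_min_time.
Qed.

Lemma F_scaleD s t u v : 0 <= s -> 0 <= t -> F u -> F v ->
  exists2 f, F f & s *: u + t *: v = (s + t) *: f.
Proof.
move=> s0 t0 Fu Fv; have [st0|st0] := eqVneq (s + t) 0.
  exists u => //; move/eqP: (st0); rewrite paddr_eq0// => /andP[/eqP-> /eqP->].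
  by rewrite addr0 !scale0r addr0.
have stp : 0 < s + t by rewrite lt0r st0 addr_ge0.
exists (s / (s + t) *: u + (1 - s / (s + t)) *: v).
  apply: F_conv => //; first by rewrite divr_ge0// ltW.
  by rewrite ler_pdivrMr// mul1r lerDl.
by rewrite scalerDr !scalerA; congr (_ *: _ + _ *: _); field.
Qed.

(** Two successive moves from [t *: F] and [s *: F] amount, by convexity, to one from
    [(t + s) *: F]. *)
Lemma min_time_triangle x Omega t v : Omega !=set0 -> 0 <= t -> F v ->
  min_time F x Omega <= t + min_time F (x + t *: v) Omega.
Proof.
move=> O0 t0 Fv; rewrite -lerBlDl; apply: min_time_ge => // s u s0 Fu Ou.
rewrite lerBlDl; have [f Ff fE] := F_scaleD t0 s0 Fv Fu.
by apply: (@min_time_le _ _ _ f) => //; rewrite ?addr_ge0// -fE addrA.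
Qed.

Lemma min_time_subset x A B : A !=set0 -> A `<=` B ->
  min_time F x B <= min_time F x A.
Proof.
move=> A0 AB; apply: min_time_ge => // t v t0 Fv Av.
by apply: (min_time_le t0 Fv); exact: AB.
Qed.

(** Makes the supremum in [removal_radius] a genuine upper bound. *)
Lemma min_time_points_bounded w (I : finType) (A : I -> set 'rV[R]_d) :
  (forall i, compact (A i)) ->
  has_ubound [set min_time F w [set y] | y in \bigcup_(i in [set: I]) A i].
Proof.
move=> Ac; have /choice[M MP] : forall i, exists M : R,
    forall y, A i y -> min_time F w [set y] <= M.
  move=> i; have [M MP] := enorm_compact_bounded (Ac i).
  exists (set_norm (polar F) * (M + enorm w)) => y Ay.
  apply: le_trans (min_time_le_enorm _ _) _.
  rewrite ler_wpM2l ?polar_set_norm_ge0//.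
  apply: le_trans (enormD _ _) _; rewrite enormN lerD2r.
  by apply: MP; exists y.
exists (\sum_i `|M i|) => _ [y [i _ Ay] <-].
apply: le_trans (MP _ _ Ay) (le_trans (ler_norm _) _).
by rewrite (bigD1 i)//= lerDl sumr_ge0.
Qed.

End MinTime.

(** * The objective function *)

Section FiniteInf.

Context {R : realType}.

Lemma finite_has_lbound (I : finType) (f : I -> R) : has_lbound (range f).
Proof.
exists (- \sum_i `|f i|) => _ [i _ <-]; rewrite lerNl.
apply: le_trans (ler_norm _) _; rewrite normrN (bigD1 i)//= lerDl.
exact: sumr_ge0.
Qed.

Lemma inf_range_le (I : finType) (f : I -> R) i : inf (range f) <= f i.
Proof. by apply: ge_inf; [exact: finite_has_lbound|exists i]. Qed.

Lemma inf_range_attained (I : finType) (f : I -> R) (i0 : I) :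
  exists i, inf (range f) = f i.
Proof.
exists [arg min_(i < i0) f i]%O; case: arg_minP => // i _ imin.
apply/eqP; rewrite eq_le inf_range_le lb_le_inf//; first by exists (f i), i.
by move=> _ [k _ <-]; exact: imin.
Qed.

End FiniteInf.

(** * Deleting and inserting facilities *)

Section Objective.

Context {R : realType} {d m : nat} (F : set 'rV[R]_d).
Context (Omega : 'I_m -> set 'rV[R]_d).

Lemma row_row' l (j : 'I_l) (i : 'I_l.-1) (x : 'M[R]_(l, d)) :
  row i (row' j x) = row (lift j i) x.
Proof. by apply/rowP => c; rewrite !mxE. Qed.

Definition insert_row l (j : 'I_l) (y : 'M[R]_(l.-1, d)) (v : 'rV[R]_d) :
    'M[R]_(l, d) :=
  \matrix_(i, c) if unlift j i is Some i' then y i' c else v ord0 c.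

Lemma insert_rowK l (j : 'I_l) y v : row' j (insert_row j y v) = y.
Proof. by apply/matrixP => i c; rewrite !mxE liftK. Qed.

Lemma row_insert_row l (j : 'I_l) y v : row j (insert_row j y v) = v.
Proof. by apply/rowP => c; rewrite !mxE unlift_none. Qed.

Lemma objective_le_row' l (j : 'I_l) (x : 'M[R]_(l, d)) : (0 < l.-1)%N ->
  objective F Omega x <= objective F Omega (row' j x).
Proof.
move=> l0; apply: ler_sum => i _.
have [k ->] := inf_range_attained
  (fun k => min_time F (row k (row' j x)) (Omega i)) (Ordinal l0).
by rewrite row_row'; exact: inf_range_le.
Qed.

(** The strict inequality says that the row attaining each minimum is not [j], so it survives the
    deletion. *)
Lemma objective_row'_le l (j : 'I_l) (x : 'M[R]_(l, d)) :
  (forall i, inf (range (fun k => min_time F (row k x) (Omega i))) <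
             min_time F (row j x) (Omega i)) ->
  objective F Omega (row' j x) <= objective F Omega x.
Proof.
move=> far; apply: ler_sum => i _; move: (far i).
have [k ->] := inf_range_attained
  (fun k => min_time F (row k x) (Omega i)) j.
case: (unliftP j k) => [k' ->|->]; last by rewrite ltxx.
move=> _; rewrite -row_row'.
exact: (inf_range_le (fun k => min_time F (row k (row' j x)) (Omega i))).
Qed.

Lemma objective_const_le l (w : 'rV[R]_d) : (0 < l)%N ->
  objective F Omega (\matrix_(i < l) w) <= \sum_(p < m) min_time F w (Omega p).
Proof.
move=> l0; apply: ler_sum => i _.
have [k ->] := inf_range_attained
  (fun k => min_time F (row k (\matrix_(i < l) w)) (Omega i)) (Ordinal l0).
by rewrite rowK.
Qed.

(** Any competitor of [row' j x] becomes a competitor of [x] by inserting a row, at no extra cost.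
    For the same reason, refilling row [j] of [x] arbitrarily keeps it optimal. *)
Lemma solutions_row'_unbounded l (j : 'I_l) (x : 'M[R]_(l, d)) :
  (0 < d)%N -> (0 < l.-1)%N -> solutions F Omega l x ->
  objective F Omega (row' j x) <= objective F Omega x ->
  solutions F Omega l.-1 (row' j x) /\ ~ bounded_set (solutions F Omega l).
Proof.
move=> d0 l0 xsol x'x; split=> [y|[M [_ MP]]].
  apply: le_trans x'x (le_trans (xsol (insert_row j y 0)) _).
  by rewrite -[X in _ <= objective _ _ X](insert_rowK j y 0) objective_le_row'.
(* Boundedness yields every bound above [M], in particular [|M| + 1], which these entries exceed. *)
pose v : 'rV[R]_d := const_mx (`|M| + 2).
have : `|insert_row j (row' j x) v| <= `|M| + 1.
  apply: MP; first by rewrite (le_lt_trans (ler_norm M))// ltrDl.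
  move=> z; apply: le_trans (objective_le_row' j _ l0) _.
  by rewrite insert_rowK; exact: le_trans x'x (xsol z).
apply/negP; rewrite -ltNge; apply: (@lt_le_trans _ _ (`|M| + 2)).
  by rewrite ltrD2l ltrDl.
rewrite [leRHS]/Num.norm/= mx_normrE; apply/bigmax_geP; right => /=.
exists (j, Ordinal d0) => //=.
have /rowP/(_ (Ordinal d0)) := row_insert_row j (row' j x) v.
by rewrite mxE => ->; rewrite mxE ler_norm.
Qed.

End Objective.

Theorem theorem4p8 (R : realType) (d m k : nat) (F : set 'rV[R]_d)
    (Omega : 'I_m -> set 'rV[R]_d) (xbar : 'M[R]_(k, d))
    (i0 : 'I_m) (w : 'rV[R]_d) (j : 'I_k)
    (hd : (1 <= d)%N) (hm : (2 <= m)%N) (hk2 : (2 <= k)%N) (hkm : (k <= m)%N)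
    (hFcompact : compact F) (hFconvex : convex_set F) (hF0 : interior F 0)
    (hOmega0 : forall i, Omega i !=set0)
    (hOmegac : forall i, compact (Omega i))
    (hxbar : solutions F Omega k xbar)
    (hw : Omega i0 w)
    (hj : ~ enlargement F (Omega i0) (removal_radius F Omega w) (row j xbar)) :
  solutions F Omega k.-1 (row' j xbar) /\
  ~ bounded_set (solutions F Omega k).
Proof.
apply: solutions_row'_unbounded => //; first by rewrite -ltnS (ltn_predK hk2).
apply: objective_row'_le => p.
pose K := set_norm F * set_norm (polar F).
pose S := \sum_(p < m) min_time F w (Omega p).
pose M := sup [set min_time F w [set w'] |
  w' in \bigcup_(p in [set: 'I_m]) Omega p].
have K1 : 1 <= K by exact: set_norm_polar_ge1.
have S0 : 0 <= S by apply: sumr_ge0 => i _; exact: min_time_ge0.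
(* Costs are nonnegative, so one summand is at most the optimal total, itself at most the cost of
   [k] copies of [w]. *)
have xbar_le : inf (range (fun i => min_time F (row i xbar) (Omega p))) <= S.
  apply: le_trans (le_trans (hxbar _) (objective_const_le F Omega w (ltnW hk2))).
  rewrite /objective (bigD1 p)//= lerDl; apply: sumr_ge0 => i _.
  have [q ->] := inf_range_attained
    (fun q => min_time F (row q xbar) (Omega i)) j.
  exact: min_time_ge0.
have radiusE : removal_radius F Omega w = K ^+ 2 * S + K * M.
  rewrite /removal_radius -/K -/S -/M; field.
  by rewrite gt_eqF// (lt_le_trans ltr01).
have far : K ^+ 2 * S + K * M < min_time F (row j xbar) (Omega i0).
  by rewrite -radiusE ltNge; apply/negP.
(* From a point [y] of [Omega p] reached at time [t], one can go on to [w] in Omega [i0]; this takes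
   at most [K] times the travel time from [w] to [y], hence at most [K * M]. *)
have near : min_time F (row j xbar) (Omega i0) - K * M <=
    min_time F (row j xbar) (Omega p).
  apply: min_time_ge => // t v t0 Fv Ov; rewrite lerBlDr.
  apply: le_trans (min_time_triangle _ _ _ _ _ t0 Fv) _ => //.
  rewrite lerD2l; set y := _ + _ in Ov *.
  apply: (@le_trans _ _ (min_time F y [set w])).
    by apply: min_time_subset => //; [exists w|move=> _ ->].
  apply: le_trans (min_time_sym _ _ _ _ _ hd) _ => //.
  rewrite ler_pM2l ?(lt_le_trans ltr01)//; apply: ub_le_sup.
    exact: min_time_points_bounded.
  by exists y => //; exists p.
have : S <= K ^+ 2 * S by rewrite ler_peMl// exprn_ege1.
lra.
Qed.
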